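(* Let $K_0,\dots,K_n$ be strictly concave kernel functions. Then for each simplex $S=S_\sigma$ there exists an equioscillation point in $\overline{S}$. Moreover, if either all the kernels belong to $\mathrm{C}^1(0,2\pi)$ or at least $n$ of them satisfy condition $(\infty')$, then every equioscillation point in $\overline{S}$ belongs to the open simplex $S$.
   Context: Identify the torus $\mathbb{T}=\mathbb{R}/2\pi\mathbb{Z}$ with $[0,2\pi)$. A concave kernel function is a $2\pi$-periodic function $K:\mathbb{R}\to[-\infty,\infty)$ which is real-valued and concave on $(0,2\pi)$ and such that $\lim_{t\downarrow0}K(t)$ and $\lim_{t\uparrow2\pi}K(t)$ exist in $[-\infty,\infty)$ and are equal; it is strictly concave if strictly concave on $(0,2\pi)$. Condition $(\infty')$: either $\lim_{t\uparrow2\pi}D_-K(t)=\lim_{t\uparrow2\pi}D_+K(t)=-\infty$, or $\lim_{t\downarrow0}D_-K(t)=\lim_{t\downarrow0}D_+K(t)=+\infty$ ($D_\pm$ one-sided derivatives). For $\mathbf{y}=(y_1,\dots,y_n)\in\mathbb{T}^n$ put $y_0=0$, $y_{n+1}=2\pi$ and $F(\mathbf{y},t)=K_0(t)+\sum_{j=1}^nK_j(t-y_j)$. For a permutation $\sigma$ of $\{1,\dots,n\}$ with $\sigma(0)=0,\sigma(n+1)=n+1$, $S_\sigma=\{\mathbf{y}:0<y_{\sigma(1)}<\dots<y_{\sigma(n)}<2\pi\}$, $\overline{S_\sigma}$ the set where $0\le y_{\sigma(1)}\le\dots\le y_{\sigma(n)}\le2\pi$; for $\mathbf{y}\in\overline{S_\sigma}$,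 $I_{\sigma(k)}(\mathbf{y})=[y_{\sigma(k)},y_{\sigma(k+1)}]$ and $m_{\sigma(k)}(\mathbf{y})=\sup_{t\in I_{\sigma(k)}(\mathbf{y})}F(\mathbf{y},t)$, $k=0,\dots,n$. A point $\mathbf{y}\in\overline{S_\sigma}$ is an equioscillation point if $m_0(\mathbf{y})=\dots=m_n(\mathbf{y})$.
   Formalization: Each kernel is also required to take at 0 (hence at 2π) the common value of its limits at 0+ and 2π−; without this, a kernel with a large finite value at 0 makes boundary points equioscillate even for C¹ kernels. *)

(* Defs.v *)
From HB Require Import structures.
From mathcomp Require Import all_boot all_order all_algebra fingroup perm.
From mathcomp Require Import all_classical all_reals all_analysis.
Set Implicit Arguments. Unset Strict Implicit. Unset Printing Implicit Defensive.
Import Order.TTheory GRing.Theory Num.Theory.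
Import numFieldNormedType.Exports.
Local Open Scope classical_set_scope.
Local Open Scope ring_scope.

Section Kernels.
Variable R : realType.
Implicit Types K : R -> \bar R.

Definition twopi : R := 2 * pi.

(* the real-valued restriction used on (0, 2pi), where K is finite *)
Definition kr K (t : R) : R := fine (K t).

Definition concave_kernel K : Prop :=
  [/\ (forall t, K (t + twopi) = K t) /\ (forall t, K t != +oo%E),
      (forall t, 0 < t < twopi -> K t \is a fin_num),
      (forall x y (l : R), 0 < x < twopi -> 0 < y < twopi -> 0 <= l <= 1 ->
         l * kr K x + (1 - l) * kr K y <= kr K (l * x + (1 - l) * y)),
      (K t @[t --> 0^'+] --> K 0) &
      (K t @[t --> twopi^'-] --> K 0)].

Definition strictly_concave_kernel K : Prop :=
  concave_kernel K /\
  (forall x y (l : R), 0 < x < twopi -> 0 < y < twopi -> x != y -> 0 < l < 1 ->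
      l * kr K x + (1 - l) * kr K y < kr K (l * x + (1 - l) * y)).

Definition Dplus K (t : R) : R :=
  lim ((fun h => (kr K (t + h) - kr K t) / h) @ 0^'+).
Definition Dminus K (t : R) : R :=
  lim ((fun h => (kr K t - kr K (t - h)) / h) @ 0^'+).

Definition cond_inf' K : Prop :=
  ((Dminus K t)%:E @[t --> twopi^'-] --> -oo%E /\
   (Dplus K t)%:E @[t --> twopi^'-] --> -oo%E) \/
  ((Dminus K t)%:E @[t --> 0^'+] --> +oo%E /\
   (Dplus K t)%:E @[t --> 0^'+] --> +oo%E).

Definition C1_kernel K : Prop :=
  (forall t, 0 < t < twopi -> derivable (kr K) t 1) /\
  {in `]0, twopi[, continuous (derive1 (kr K))}.

Variable n : nat.

(* sum of translates F(y,t) = K_0(t) + sum_j K_j(t - y_j); the kernel K_j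
   (j = 1..n) is Ks (lift ord0 j) for j : 'I_n, K_0 is Ks ord0 *)
Definition Fsum (Ks : 'I_n.+1 -> R -> \bar R) (y : 'I_n -> R) (t : R) : \bar R :=
  (Ks ord0 t + \sum_(j < n) Ks (lift ord0 j) (t - y j)%R)%E.

(* sorted node positions: y_{sigma(0)} = 0, y_{sigma(k)} for 1 <= k <= n,
   y_{sigma(n+1)} = 2pi *)
Definition node (s : {perm 'I_n}) (y : 'I_n -> R) (k : nat) : R :=
  match k with
  | 0 => 0
  | k'.+1 => match (insub k' : option 'I_n) with
             | Some i => y (s i)
             | None => twopi
             end
  end.

Definition closed_simplex (s : {perm 'I_n}) (y : 'I_n -> R) : Prop :=
  forall k : 'I_n.+1, node s y k <= node s y k.+1.

Definition open_simplex (s : {perm 'I_n}) (y : 'I_n -> R) : Prop :=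
  forall k : 'I_n.+1, node s y k < node s y k.+1.

Definition msup (Ks : 'I_n.+1 -> R -> \bar R) (s : {perm 'I_n}) (y : 'I_n -> R)
    (k : nat) : \bar R :=
  ereal_sup [set Fsum Ks y t | t in [set t | node s y k <= t <= node s y k.+1]].

Definition equioscillation_point (Ks : 'I_n.+1 -> R -> \bar R) (s : {perm 'I_n})
    (y : 'I_n -> R) : Prop :=
  closed_simplex s y /\ forall k l : 'I_n.+1, msup Ks s y k = msup Ks s y l.

End Kernels.

(* Main.v *)
Require Import Defs.
From HB Require Import structures.
From mathcomp Require Import all_boot all_order all_algebra fingroup perm.
From mathcomp Require Import all_classical all_reals all_analysis.
From mathcomp Require Import ring lra zify.
Set Implicit Arguments. Unset Strict Implicit. Unset Printing Implicit Defensive.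
Import Order.TTheory GRing.Theory Num.Theory.
Import numFieldNormedType.Exports.
Local Open Scope classical_set_scope.
Local Open Scope ring_scope.

(** Existence.  Call a point y of the closed simplex sorted if
    m_0(y) <= ... <= m_n(y) (intervals numbered from left to right).  The sorted
    points form a compact set containing the origin; take one maximising the
    sum of the coordinates.  If m_{k-1} < m_k held there, the interval I_k would be
    nondegenerate, so its left node could be moved slightly to the right.
    By concavity, moving that node by e changes F by K(t - e) - K(t), which
    increases from left to right on the complement of the moved stretch, so all
    the other inequalities m_{j-1} <= m_j survive, against maximality.  Hence all
    the m_k coincide.

    Interior.  If an equioscillation point has a degenerate interval {p}, then p
    is a global maximum of F, and at least two kernels have their singularity at
    p.  A kernel whose singularity is at p has a strict V-shaped local minimum
    there (infinitely steep on one side under condition (infinity')), whereas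
    the others are differentiable at p in the C^1 case and have finite one-sided
    slopes in any case; so F increases on one side of p. *)

(** * Concave kernels *)

Section KernelTheory.
Variable R : realType.
Implicit Types (K : R -> \bar R) (a b c x t h : R).
Notation twopi := (twopi R).

Lemma twopi_gt0 : 0 < twopi.
Proof. by rewrite mulr_gt0 // pi_gt0. Qed.

Lemma twopi_mod x : exists z : int, 0 <= x + z%:~R * twopi < twopi.
Proof.
exists (- Num.floor (x / twopi)).
rewrite mulrNz mulNr subr_ge0 ltrBlDl -ler_pdivlMr ?twopi_gt0 //.
rewrite -[X in _ + X]mul1r -mulrDl -ltr_pdivrMr ?twopi_gt0 //.
by have := floor_itv (x / twopi); rewrite intrD.
Qed.

Section ConcaveKernel.
Variable K : R -> \bar R.
Hypothesis cK : concave_kernel K.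

Lemma kernel_neqy t : K t != +oo%E.
Proof. by case: cK => -[]. Qed.

Lemma kernel_fin t : 0 < t < twopi -> K t \is a fin_num.
Proof. by case: cK => _ + _ _ _; apply. Qed.

Lemma kernel_periodicz (z : int) t : K (t + z%:~R * twopi) = K t.
Proof.
have KD u : K (u + twopi) = K u by case: cK => -[].
have Kn m u : K (u + m%:R * twopi) = K u.
  elim: m u => [|m IHm] u; first by rewrite mul0r addr0.
  by rewrite -natr1 mulrDl mul1r addrA KD.
case: (intP z) => [|m|m]; first by rewrite mul0r addr0.
  exact: Kn.
by rewrite mulrNz mulNr -[LHS](Kn m.+1) subrK.
Qed.

Lemma kernel_twopi : K twopi = K 0.
Proof. by rewrite -[RHS](kernel_periodicz 1) mul1r add0r. Qed.

(** Concavity with weight [(c - b) / (c - a)] on [a], multiplied out by [c - a]: in this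
    division-free form every later use is left to linear arithmetic. *)
Lemma kernel_three_open a b c : 0 < a -> a < b -> b < c -> c < twopi ->
  (c - b) * kr K a + (b - a) * kr K c <= (c - a) * kr K b.
Proof.
move=> a0 ab bc c2.
have ca0 : 0 < c - a by lra.
case: cK => _ _ /(_ a c ((c - b) / (c - a))) + _ _.
have -> : 1 - (c - b) / (c - a) = (b - a) / (c - a) by field; lra.
have -> : (c - b) / (c - a) * a + (b - a) / (c - a) * c = b by field; lra.
move=> H; have {}H := H _ _ _.
have : (c - b) / (c - a) * kr K a + (b - a) / (c - a) * kr K c <= kr K b.
  apply: H; [lra|lra|].
  by rewrite divr_ge0 ?ler_pdivrMr //=; lra.
rewrite -(ler_pM2l ca0); congr (_ <= _); field; lra.
Qed.

Lemma kr_cvg0 : K 0 \is a fin_num -> kr K t @[t --> 0^'+] --> kr K 0.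
Proof.
move=> K0; case: cK => _ _ _ K0r _; apply: fine_cvg.
by rewrite /kr fineK.
Qed.

Lemma kr_cvg_twopi : K 0 \is a fin_num -> kr K t @[t --> twopi^'-] --> kr K 0.
Proof.
move=> K0; case: cK => _ _ _ _ K0l; apply: fine_cvg.
by rewrite /kr fineK.
Qed.

(** The open case passes to the limit at the ends of the period, where the kernel has one-sided
    limits; finiteness of the end values lets the limits be taken in the reals. *)
Lemma kernel_three a b c : 0 <= a -> a < b -> b < c -> c <= twopi ->
  K a \is a fin_num -> K c \is a fin_num ->
  (c - b) * kr K a + (b - a) * kr K c <= (c - a) * kr K b.
Proof.
move=> + ab bc.
(* The end [a = 0] is reached by letting [u] decrease to 0, the end [c = twopi] afterwards by
   letting [u] increase to [twopi]. *)
wlog a0 : a ab / 0 < a => [H|_].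
  rewrite le_eqVlt => /orP[/eqP a0|a0]; last by apply: H => //; exact: ltW.
  rewrite -{}a0 in ab * => c2 K0 Kc.
  rewrite -subr_ge0.
  have cv : (c - u) * kr K b - ((c - b) * kr K u + (b - u) * kr K c)
      @[u --> 0^'+] -->
      (c - 0) * kr K b - ((c - b) * kr K 0 + (b - 0) * kr K c).
    apply: cvgB; first by apply: cvgMr_tmp; apply: cvgB (cvg_cst _) _;
      exact: cvg_at_right_filter.
    apply: cvgD; first by apply: cvgMl_tmp; exact: kr_cvg0 K0.
    by apply: cvgMr_tmp; apply: cvgB (cvg_cst _) _; exact: cvg_at_right_filter.
  apply: (cvgr_to_ge cv).
  near=> u; rewrite subr_ge0.
  have u0 : 0 < u by near: u; exact: nbhs_right_gt.
  have ub : u < b by near: u; exact: nbhs_right_lt.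
  by apply: H => //; apply: kernel_fin; lra.
rewrite le_eqVlt => /orP[/eqP c2 Ka Kc|c2 _ _]; last exact: kernel_three_open.
rewrite c2 in bc Kc *; rewrite kernel_twopi in Kc.
have -> : kr K twopi = kr K 0 by rewrite /kr kernel_twopi.
rewrite -subr_ge0.
have cv : (u - a) * kr K b - ((u - b) * kr K a + (b - a) * kr K u)
    @[u --> twopi^'-] -->
    (twopi - a) * kr K b - ((twopi - b) * kr K a + (b - a) * kr K 0).
  apply: cvgB; first by apply: cvgMr_tmp; apply: cvgB _ (cvg_cst _);
    exact: cvg_at_left_filter.
  apply: cvgD; last by apply: cvgMl_tmp; exact: kr_cvg_twopi Kc.
  by apply: cvgMr_tmp; apply: cvgB _ (cvg_cst _); exact: cvg_at_left_filter.
apply: (cvgr_to_ge cv).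
near=> u; rewrite subr_ge0.
have bu : b < u by near: u; exact: nbhs_left_gt.
have u2 : u < twopi by near: u; exact: nbhs_left_lt.
exact: kernel_three_open.
Unshelve. all: by end_near.
Qed.

(** The increments at [x] are squeezed between chord slopes taken towards [x - d] and [x + d], which
    gives a Lipschitz bound at [x] with constant [C / d]. *)
Lemma kr_continuous x : 0 < x < twopi -> {for x, continuous (kr K)}.
Proof.
move=> /andP[x0 x2].
pose d : R := Num.min x (twopi - x) / 2.
have d0 : 0 < d by rewrite divr_gt0 // lt_min x0 subr_gt0.
have dx : d < x /\ x + d < twopi.
  have m0 : 0 < Num.min x (twopi - x) by rewrite lt_min x0 subr_gt0.
  have := ge_min x x (twopi - x); have := ge_min (twopi - x) x (twopi - x).
  rewrite !lexx orbT /= => m2 m1; rewrite /d; lra.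
case: dx => dx dx2.
pose C : R := `|kr K (x + d) - kr K x| + `|kr K x - kr K (x - d)|.
have C0 : 0 <= C by rewrite addr_ge0.
have lip h : `|h| < d -> d * `|kr K (x + h) - kr K x| <= C * `|h|.
  rewrite -[X in X * `|kr K _ - _|](gtr0_norm d0) -normrM ltr_norml ler_norml.
  have lB := ler_norm (kr K (x + d) - kr K x).
  have lA := ler_norm (kr K x - kr K (x - d)).
  have := ler_norm (- (kr K (x + d) - kr K x)).
  have := ler_norm (- (kr K x - kr K (x - d))).
  rewrite !normrN => lA' lB'; rewrite /C.
  move=> /andP[hd1 hd2]; case: (ltgtP h 0) => [h0|h0|->]; last first.
  - by rewrite normr0 addr0 subrr !mulr0 oppr0 lexx.
  - rewrite (gtr0_norm h0); have h0' : 0 <= h by lra.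
    have p1 := ler_wpM2l h0' lA; have p2 := ler_wpM2l h0' lA'.
    have p3 := ler_wpM2l h0' lB; have p4 := ler_wpM2l h0' lB'.
    have H1 : (x + h - x) * kr K (x - d) + (x - (x - d)) * kr K (x + h) <=
              (x + h - (x - d)) * kr K x by apply: kernel_three_open; lra.
    have H2 : (x + d - (x + h)) * kr K x + (x + h - x) * kr K (x + d) <=
              (x + d - x) * kr K (x + h) by apply: kernel_three_open; lra.
    by apply/andP; split; lra.
  - rewrite (ltr0_norm h0); have h0' : 0 <= - h by lra.
    have p1 := ler_wpM2l h0' lA; have p2 := ler_wpM2l h0' lA'.
    have p3 := ler_wpM2l h0' lB; have p4 := ler_wpM2l h0' lB'.
    have H1 : (x + d - x) * kr K (x + h) + (x - (x + h)) * kr K (x + d) <=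
              (x + d - (x + h)) * kr K x by apply: kernel_three_open; lra.
    have H2 : (x - (x + h)) * kr K (x - d) + (x + h - (x - d)) * kr K x <=
              (x - (x - d)) * kr K (x + h) by apply: kernel_three_open; lra.
    by apply/andP; split; lra.
apply/cvgrPdist_lt => e e0.
(* The division is by [C + 1] because [C] may be zero. *)
have [eps eps0 epsE] : exists2 eps : R, 0 < eps & forall u : R,
    u < eps -> u < d /\ u < d * e / (C + 1).
  exists (Num.min d (d * e / (C + 1))) => [|u].
    rewrite lt_min d0 /=; apply: divr_gt0; first exact: mulr_gt0.
    exact: ltr_wpDl.
  by rewrite lt_min => /andP.
near=> t.
have : `|t - x| < eps by rewrite distrC; near: t; apply/nbhs_ballP; exists eps.
move=> /epsE[td].
rewrite ltr_pdivlMr; last by lra.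
move=> tde; have := lip _ td; rewrite (addrC x) subrK distrC => H.
rewrite -(ltr_pM2l d0) (le_lt_trans H) // (le_lt_trans _ tde) //.
by rewrite mulrC ler_wpM2l // lerDl.
Unshelve. all: by end_near.
Qed.

(** Continuity holds in the extended reals, also where the value is [-oo]: at 0 it is the
    conjunction of the two one-sided limits, the left one being carried over from [twopi] by
    periodicity. *)
Lemma kernel_continuous : continuous K.
Proof.
move=> x.
have Kx y : 0 <= y < twopi -> {for y, continuous K}.
  move=> /andP[]; rewrite le_eqVlt => /orP[/eqP <- _|y0 y2].
    have K0r : K t @[t --> 0^'+] --> K 0 by case: cK.
    have K0l : K t @[t --> 0^'-] --> K 0.
      have [_ _ _ _ K2] := cK.
      have -> : K = K \o (fun t => t + twopi).
        by apply/funext => t /=; rewrite -[LHS](kernel_periodicz 1) mul1r.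
      rewrite /= add0r kernel_twopi; apply: cvg_comp K2.
      move=> P; rewrite /nbhs/= => /nbhs_left0P P2; apply/nbhs_left0P.
      by apply: filterS P2 => h; rewrite /preimage /= sub0r addrC.
    move=> P P0.
    have Pr : \forall t \near nbhs (0 : R), 0 < t -> P (K t) := K0r P P0.
    have Pl : \forall t \near nbhs (0 : R), t < 0 -> P (K t) := K0l P P0.
    suff : \forall t \near nbhs (0 : R), P (K t) by [].
    near=> t.
    have [t0|t0|<-] := ltgtP 0 t; last exact: nbhs_singleton.
      by apply: (near Pr t).
    by apply: (near Pl t).
  have yin : 0 < y < twopi by rewrite y0.
  have := kr_continuous yin; rewrite /prop_for /continuous_at => kry.
  rewrite -(fineK (kernel_fin yin)); apply/fine_cvgP; split => //.
  near=> t; apply: kernel_fin; apply/andP; split; near: t.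
    exact: lt_nbhsr.
  exact: lt_nbhsl.
have [z xz] := twopi_mod x.
have -> : K = K \o (fun t => t + z%:~R * twopi).
  by apply/funext => t /=; rewrite kernel_periodicz.
apply: continuous_comp; last exact: Kx.
by apply: cvgD => //; exact: cvg_cst.
Unshelve. all: by end_near.
Qed.

(** This says that [K (t - e) - K t] does not decrease from [t = r] to [t = s], written with sums so
    as to make sense for infinite values. Only [s] and [r - e] can be ends of the period, and a
    value [-oo] there makes the left side [-oo]. Otherwise [r] and [s - e] both lie between [r - e]
    and [s], and two concavity inequalities are added. *)
Lemma kernel_shift r s e : 0 < e -> e <= r -> r < s -> s <= twopi ->
  (K s + K (r - e)%R <= K (s - e)%R + K r)%E.
Proof.
move=> e0 er rs s2.
have Krf : K r \is a fin_num by apply: kernel_fin; lra.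
have Ksf : K (s - e) \is a fin_num by apply: kernel_fin; lra.
have [sf|] := boolP (K s \is a fin_num); last first.
  by rewrite fin_numE kernel_neqy andbT negbK => /eqP ->; rewrite leNye.
have [ref|] := boolP (K (r - e) \is a fin_num); last first.
  by rewrite fin_numE kernel_neqy andbT negbK => /eqP ->; rewrite addeNy leNye.
rewrite -(fineK Krf) -(fineK Ksf) -(fineK sf) -(fineK ref) -!EFinD lee_fin.
have H1 : (s - r) * kr K (r - e) + (r - (r - e)) * kr K s <=
          (s - (r - e)) * kr K r by apply: kernel_three => //; lra.
have H2 : (s - (s - e)) * kr K (r - e) + (s - e - (r - e)) * kr K s <=
          (s - (r - e)) * kr K (s - e) by apply: kernel_three => //; lra.
have d0 : 0 < s - (r - e) by lra.
rewrite -(ler_pM2l d0) -/(kr K s) -/(kr K r).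
by rewrite -/(kr K (r - e)) -/(kr K (s - e)); lra.
Qed.

End ConcaveKernel.
End KernelTheory.

(** * One-sided slopes *)

Section OneSided.
Variable R : realType.
Implicit Types (K : R -> \bar R) (a b c x t h : R).
Notation twopi := (twopi R).

(** Common last step of both interior arguments: first-order lower bounds for the separate kernels
    add up to a positive increment of the whole sum. *)
Lemma sum_gt0_near (I : finType) (g : I -> R -> R) (C : I -> R) :
  (forall i, \forall h \near 0^'+, C i * h <= g i h) -> 0 < \sum_i C i ->
  \forall h \near 0^'+, 0 < \sum_i g i h.
Proof.
move=> gC C0; have gC' := filter_forall _ gC.
near=> h; have h0 : 0 < h by near: h; exact: nbhs_right_gt.
apply: lt_le_trans (mulr_gt0 C0 h0) _; rewrite mulr_suml.
have Ch : forall i, C i * h <= g i h by near: h; exact: gC'.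
by apply: ler_sum => i _.
Unshelve. all: by end_near.
Qed.

(** Reflection exchanges left and right, so that one-sided estimates need a proof on the right
    only. *)
Definition reflect_kernel K t := K (- t).

Lemma reflect_kernelE K t : concave_kernel K ->
  reflect_kernel K t = K (twopi - t).
Proof.
move=> cK; rewrite -[RHS](kernel_periodicz cK (-1)).
by rewrite mulN1r addrAC subrr add0r.
Qed.

Lemma concave_reflect K : concave_kernel K -> concave_kernel (reflect_kernel K).
Proof.
move=> cK; have rE := reflect_kernelE _ cK.
have krE t : kr (reflect_kernel K) t = kr K (twopi - t) by rewrite /kr rE.
have [[KD Ky] Kf Kc K0 K2] := cK; split.
- split=> t; last exact: Ky.
  rewrite /reflect_kernel opprD.
  by rewrite -[LHS]KD subrK.
- by move=> t t2; rewrite rE; apply: Kf; lra.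
- move=> x y l x2 y2 l1; rewrite !krE.
  have -> : twopi - (l * x + (1 - l) * y) =
      l * (twopi - x) + (1 - l) * (twopi - y).
    by ring.
  by apply: Kc => //; lra.
- rewrite (funext rE) subr0 (kernel_twopi cK); apply: cvg_comp K2.
  move=> P; rewrite /nbhs /= => /nbhs_left0P; exact.
- rewrite (funext rE) subr0 (kernel_twopi cK); apply: cvg_comp K0.
  move=> P; rewrite /nbhs /= => /nbhs_right0P P0; apply/nbhs_left0P.
  by apply: filterS P0 => h; rewrite /= subKr add0r.
Qed.

Lemma strictly_concave_reflect K :
  strictly_concave_kernel K -> strictly_concave_kernel (reflect_kernel K).
Proof.
move=> [cK sK]; split; first exact: concave_reflect.
have krE t : kr (reflect_kernel K) t = kr K (twopi - t).
  by rewrite /kr reflect_kernelE.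
move=> x y l x2 y2 xy l1; rewrite !krE.
have -> : twopi - (l * x + (1 - l) * y) =
      l * (twopi - x) + (1 - l) * (twopi - y).
  by ring.
by apply: sK => //; lra.
Qed.

(** * Estimates to the right of a point *)

Section RightHalf.
Variable K : R -> \bar R.
Hypothesis cK : concave_kernel K.

Lemma kernel_fin_right x : \forall h \near 0^'+, K (x + h) \is a fin_num.
Proof.
have [z /andP[r0 r2]] := twopi_mod x.
near=> h; rewrite -(kernel_periodicz cK z) addrAC.
apply: (kernel_fin cK).
have h0 : 0 < h by near: h; exact: nbhs_right_gt.
have h2 : h < twopi - (x + z%:~R * twopi).
  by near: h; apply: nbhs_right_lt; rewrite subr_gt0.
by lra.
Unshelve. all: by end_near.
Qed.

(** By concavity the right difference quotients are at least the slope of a fixed longer chord. This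
    includes the case where [x] is a singularity with finite value. *)
Lemma kernel_lipschitz_right x : K x \is a fin_num ->
  exists C, \forall h \near 0^'+, C * h <= kr K (x + h) - kr K x.
Proof.
have [z /andP[r0 r2]] := twopi_mod x.
have krE h : kr K (x + h) = kr K (x + z%:~R * twopi + h).
  by rewrite /kr -(kernel_periodicz cK z) addrAC.
rewrite -(kernel_periodicz cK z) -[in kr K x](addr0 x) => Kr.
rewrite (krE 0) addr0.
set r := x + z%:~R * twopi in r0 r2 krE Kr *.
have [d d0 rd] : exists2 d : R, 0 < d & r + d < twopi.
  by exists ((twopi - r) / 2); lra.
exists ((kr K (r + d) - kr K r) / d); near=> h.
have h0 : 0 < h by near: h; exact: nbhs_right_gt.
have hd : h < d by near: h; exact: nbhs_right_lt.
rewrite krE mulrAC ler_pdivrMr //.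
have : (r + d - (r + h)) * kr K r + (r + h - r) * kr K (r + d) <=
       (r + d - r) * kr K (r + h).
  by apply: (kernel_three cK) => //; try lra; apply: (kernel_fin cK); lra.
by lra.
Unshelve. all: by end_near.
Qed.

(** Since the values at 0 and [twopi] agree, concavity keeps [K] above [K 0], and strictness gives a
    strict inequality at [pi]. The chord from 0 to [pi] then has positive slope and lies below the
    graph. *)
Lemma kernel_slope_right_gt0 : strictly_concave_kernel K -> K 0 \is a fin_num ->
  exists2 c, 0 < c & \forall h \near 0^'+, c * h <= kr K h - kr K 0.
Proof.
move=> [_ sK] K0; have pi0 := pi_gt0 R.
have K2 : K twopi \is a fin_num by rewrite kernel_twopi.
have kr2 : kr K twopi = kr K 0 by rewrite /kr kernel_twopi.
have two : twopi = 2 * pi by [].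
have ge b : 0 < b < twopi -> kr K 0 <= kr K b.
  move=> b2; rewrite -(ler_pM2l (twopi_gt0 R)).
  have : (twopi - b) * kr K 0 + (b - 0) * kr K twopi <= (twopi - 0) * kr K b.
    by apply: (kernel_three cK) => //; lra.
  by rewrite kr2; lra.
(* Strictness is available only between interior points, so [pi] is taken as the midpoint of
   [pi / 2] and [3 pi / 2]. *)
have gtpi : kr K 0 < kr K pi.
  have := sK (pi / 2) (pi * (3 / 2)) (1 / 2).
  have -> : 1 / 2 * (pi / 2) + (1 - 1 / 2) * (pi * (3 / 2)) = pi :> R by field.
  have := ge (pi / 2) _; have := ge (pi * (3 / 2)) _.
  rewrite two => H1 H2 H3.
  have {}H1 : kr K 0 <= kr K (pi * (3 / 2)) by apply: H1; lra.
  have {}H2 : kr K 0 <= kr K (pi / 2) by apply: H2; lra.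
  have {}H3 : 1 / 2 * kr K (pi / 2) + (1 - 1 / 2) * kr K (pi * (3 / 2)) < kr K pi.
    by apply: H3; lra.
  lra.
exists ((kr K pi - kr K 0) / pi); first by rewrite divr_gt0 // subr_gt0.
near=> h.
have h0 : 0 < h by near: h; exact: nbhs_right_gt.
have hpi : h < pi by near: h; exact: nbhs_right_lt.
rewrite mulrAC ler_pdivrMr //.
have : (pi - h) * kr K 0 + (h - 0) * kr K pi <= (pi - 0) * kr K h.
  by apply: (kernel_three cK) => //; [lra|apply: (kernel_fin cK); lra].
by lra.
Unshelve. all: by end_near.
Qed.

(** The quotients increase as [h] decreases to 0 and are bounded by the slope of the chord from
    [t / 2] to [t]. Existence of this limit is what gives the [lim] in [Dplus] its meaning. *)
Lemma Dplus_cvg t : 0 < t < twopi ->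
  cvg ((fun h => (kr K (t + h) - kr K t) / h) @ 0^'+).
Proof.
move=> /andP[t0 t2]; apply/cvg_ex; eexists.
apply: (@nonincreasing_at_right_cvgr _ _ 0 (BLeft (twopi - t))).
- by rewrite bnd_simp subr_gt0.
- move=> a b; rewrite !in_itv /= => /andP[a0 a2] /andP[b0 b2].
  rewrite le_eqVlt => /orP[/eqP -> //|ab].
  rewrite ler_pdivrMr // mulrAC ler_pdivlMr //.
  have : (t + b - (t + a)) * kr K t + (t + a - t) * kr K (t + b) <=
         (t + b - t) * kr K (t + a) by apply: (kernel_three_open cK); lra.
  lra.
- exists ((kr K t - kr K (t / 2)) / (t / 2)) => _ [h /= + <-].
  rewrite in_itv /= => /andP[h0 h2].
  rewrite ler_pdivrMr // mulrAC ler_pdivlMr //; last by lra.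
  have : (t + h - t) * kr K (t / 2) + (t - t / 2) * kr K (t + h) <=
         (t + h - t / 2) * kr K t by apply: (kernel_three_open cK); lra.
  lra.
Qed.

(** Allowing [u = 0] is the point: it turns information on derivatives near the singularity into
    information on increments from the singularity itself. *)
Lemma Dplus_le t u : 0 <= u -> u < t -> t < twopi -> K u \is a fin_num ->
  Dplus K t * (t - u) <= kr K t - kr K u.
Proof.
move=> u0 ut t2 Ku; rewrite -ler_pdivlMr ?subr_gt0 //.
apply: limr_le; first by apply: Dplus_cvg; lra.
near=> h.
have h0 : 0 < h by near: h; exact: nbhs_right_gt.
have h2 : h < twopi - t by near: h; apply: nbhs_right_lt; rewrite subr_gt0.
rewrite ler_pdivrMr // mulrAC ler_pdivlMr ?subr_gt0 //.
have : (t + h - t) * kr K u + (t - u) * kr K (t + h) <=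
       (t + h - u) * kr K t.
  by apply: (kernel_three cK) => //; try lra; apply: (kernel_fin cK); lra.
by lra.
Unshelve. all: by end_near.
Qed.

End RightHalf.

(** The sign [e] selects the side of [x]; the case [-1] is the right-hand statement for the
    reflected kernel at [- x]. *)
Lemma kernel_fin_side K e x : concave_kernel K -> e = 1 \/ e = -1 ->
  \forall h \near 0^'+, K (x + e * h) \is a fin_num.
Proof.
move=> cK [->|->].
  by under eq_near do rewrite mul1r; exact: kernel_fin_right.
apply: filterS (kernel_fin_right (concave_reflect cK) (- x)) => h.
by rewrite /reflect_kernel opprD opprK mulN1r.
Qed.

Lemma kernel_lipschitz_side K e x : concave_kernel K -> e = 1 \/ e = -1 ->
  K x \is a fin_num ->
  exists C, \forall h \near 0^'+, C * h <= kr K (x + e * h) - kr K x.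
Proof.
move=> cK [->|->] Kx.
  have [C HC] := kernel_lipschitz_right cK Kx; exists C.
  by apply: filterS HC => h; rewrite mul1r.
have Kx' : reflect_kernel K (- x) \is a fin_num by rewrite /reflect_kernel opprK.
have [C HC] := kernel_lipschitz_right (concave_reflect cK) Kx'; exists C.
by apply: filterS HC => h; rewrite /kr /reflect_kernel opprD !opprK mulN1r.
Qed.

(** The V shape at the singularity: the right slopes of the kernel and of its reflection are both
    positive. *)
Lemma kernel_second_difference0 K : strictly_concave_kernel K ->
  K 0 \is a fin_num -> exists2 c, 0 < c &
  \forall h \near 0^'+, c * h <= (kr K h - kr K 0) + (kr K (- h) - kr K 0).
Proof.
move=> sK K0.
have [c c0 Hc] := kernel_slope_right_gt0 sK.1 sK K0.
have K0' : reflect_kernel K 0 \is a fin_num by rewrite /reflect_kernel oppr0.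
have sK' := strictly_concave_reflect sK.
have [d d0 Hd] := kernel_slope_right_gt0 sK'.1 sK' K0'.
exists (c + d); first exact: addr_gt0.
apply: filterS2 Hc Hd => h Hc; rewrite /kr /reflect_kernel oppr0 => Hd.
by rewrite mulrDl lerD.
Qed.

Lemma Dminus_reflect K t : concave_kernel K -> 0 < t < twopi ->
  Dminus K t = - Dplus (reflect_kernel K) (twopi - t).
Proof.
move=> cK t2; rewrite /Dminus /Dplus.
set g := (X in _ = - lim (X @ _)).
have -> : (fun h => (kr K t - kr K (t - h)) / h) = - g.
  apply/funext => h; transitivity (- g h) => //.
  by rewrite /g /kr !(reflect_kernelE _ cK) opprD addrA !subKr -mulNr opprB.
by apply: limN; apply: Dplus_cvg; [exact: concave_reflect|lra].
Qed.

(** The chord from 0 to [h] is at least as steep as the derivative at [h], so unbounded derivatives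
    force unbounded difference quotients at 0. Blow-up at [twopi] concerns the left side of 0 and is
    read off the reflected kernel. *)
Lemma cond_inf'_slope K : concave_kernel K -> K 0 \is a fin_num -> cond_inf' K ->
  (forall M, \forall h \near 0^'+, M * h <= kr K h - kr K 0) \/
  (forall M, \forall h \near 0^'+, M * h <= kr K (- h) - kr K 0).
Proof.
move=> cK K0 [[D2 _]|[_ D0]]; [right|left] => M.
  move/cvgeNyPle: D2 => /(_ (- M)) /nbhs_left0P DM.
  near=> h.
  have h0 : 0 < h by near: h; exact: nbhs_right_gt.
  have h2 : h < twopi by near: h; apply: nbhs_right_lt; exact: twopi_gt0.
  have : ((Dminus K (twopi - h))%:E <= (- M)%:E)%E by near: h.
  rewrite lee_fin Dminus_reflect //; last by lra.
  rewrite lerN2 subKr => MD.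
  have := Dplus_le (concave_reflect cK) (lexx 0) h0 h2.
  rewrite /kr /reflect_kernel subr0 oppr0 => /(_ K0).
  by apply: le_trans; rewrite ler_pM2r.
move/cvgeyPge: D0 => /(_ M) DM; near=> h.
have h0 : 0 < h by near: h; exact: nbhs_right_gt.
have h2 : h < twopi by near: h; apply: nbhs_right_lt; exact: twopi_gt0.
have : (M%:E <= (Dplus K h)%:E)%E by near: h.
rewrite lee_fin => MD.
have := Dplus_le cK (lexx 0) h0 h2 K0; rewrite subr0.
by apply: le_trans; rewrite ler_pM2r.
Unshelve. all: by end_near.
Qed.

(** The first-order terms of the two increments cancel; each difference quotient is within [e / 2]
    of the derivative. *)
Lemma derivable_second_difference (f : R -> R) x (e : R) : derivable f x 1 ->
  0 < e -> \forall h \near 0^'+, - e * h <= (f (x + h) - f x) + (f (x - h) - f x).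
Proof.
move=> /cvg_ex[d /cvgrPdist_lt fd] e0.
have e2 : 0 < e / 2 by lra.
have /nbhs_ballP[r /= r0 fr] := fd _ e2.
near=> h.
have h0 : 0 < h by near: h; exact: nbhs_right_gt.
have hr : h < r by near: h; exact: nbhs_right_lt.
have := fr h _ _; have := fr (- h) _ _.
rewrite /ball /= !sub0r !normrN gtr0_norm // hr oppr_eq0 gt_eqF // => H1 H2.
have {H1} := H1 isT isT; have {H2} := H2 isT isT.
rewrite !ltr_norml /GRing.scale /= !mulr1 (addrC h x) (addrC (- h) x).
rewrite invrN mulNr => /andP[_ +] /andP[+ _].
rewrite -(ltr_pM2r h0) -(ltr_pM2r h0) => H1 H2.
have E : h^-1 * (f (x + h) - f x) * h = f (x + h) - f x by field; lra.
have E' : h^-1 * (f (x - h) - f x) * h = f (x - h) - f x by field; lra.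
nra.
Unshelve. all: by end_near.
Qed.

End OneSided.

(** * Nodes and sums of translates *)

Lemma cvge_lt_near (R : realFieldType) T (F : set_system T) {FF : Filter F}
    (f g : T -> \bar R) a b :
  f @ F --> a -> g @ F --> b -> (a < b)%E -> \forall p \near F, (f p < g p)%E.
Proof.
move=> fa gb ab.
have [c ac cb] : exists2 c : R, (a < c%:E)%E & (c%:E < b)%E.
  move: a b ab {fa gb} => [a||] [b||] //; rewrite ?lte_fin.
  - by move=> ab; exists ((a + b) / 2); rewrite lte_fin; lra.
  - by move=> _; exists (a + 1); rewrite ?ltry // lte_fin; lra.
  - by move=> _; exists (b - 1); rewrite ?ltNyr // lte_fin; lra.
  - by move=> _; exists 0; rewrite ?ltry ?ltNyr.
have fc : \forall p \near F, (f p < c%:E)%E := fa _ (open_ereal_lt' ac).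
have cg : \forall p \near F, (c%:E < g p)%E := gb _ (open_ereal_gt' cb).
by apply: filterS2 fc cg => p; exact: lt_trans.
Qed.

Section Nodes.
Variables (R : realType) (n : nat) (s : {perm 'I_n}).
Implicit Types (y : 'I_n -> R) (t u : R).
Notation twopi := (twopi R).

Lemma nodeS y (i : 'I_n) : node s y i.+1 = y (s i).
Proof. by rewrite /= valK. Qed.

Lemma node_last y : node s y n.+1 = twopi.
Proof. by rewrite /= insubF // ltnn. Qed.

Lemma node_mono y i j : closed_simplex s y -> (i <= j <= n.+1)%N ->
  node s y i <= node s y j.
Proof.
move=> yS /andP[]; elim: j => [|j IHj]; first by rewrite leqn0 => /eqP ->.
rewrite leq_eqVlt => /orP[/eqP -> //|ij jn].
apply: le_trans (IHj ij (ltnW jn)) _.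
exact: (yS (Ordinal jn)).
Qed.

Lemma node_bounds y i : closed_simplex s y -> (i <= n.+1)%N ->
  0 <= node s y i <= twopi.
Proof.
move=> yS iN; rewrite -(node_last y) -[0]/(node s y 0).
by rewrite !node_mono ?iN ?leqnn.
Qed.

Lemma coord_bounds y j : closed_simplex s y -> 0 <= y j <= twopi.
Proof.
move=> yS; rewrite -(permKV s j) -nodeS node_bounds //.
by rewrite ltnS ltnW.
Qed.

(** The index is [k.+1] because node 0 is the fixed point 0, so the coordinate [s k] sits at
    position [k.+1]. *)
Lemma node_raise y y' (k : 'I_n) (e : R) i :
  (forall j, y' j = y j + e * (j == s k)%:R) ->
  node s y' i = node s y i + e * (i == k.+1)%:R.
Proof.
case: i => [|i] y'E; first by rewrite mulr0 addr0.
rewrite eqSS; have [iN|Ni] := ltnP i n.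
  by rewrite -[i]/(val (Ordinal iN)) !nodeS y'E (inj_eq perm_inj) -val_eqE.
have -> : (i == k) = false by have := ltn_ord k; lia.
by rewrite /= insubF ?mulr0 ?addr0 // ltnNge Ni.
Qed.

Lemma node_cvg T (F : set_system T) {FF : Filter F} (y : T -> 'I_n -> R) y0 i :
  (forall j, y p j @[p --> F] --> y0 j) ->
  node s (y p) i @[p --> F] --> node s y0 i.
Proof.
move=> yF; case: i => [|i]; first exact: cvg_cst.
by rewrite /=; case: insub => [j|]; [exact: yF|exact: cvg_cst].
Qed.

(** * Dependence of the sum of translates on the nodes *)

Variable Ks : 'I_n.+1 -> R -> \bar R.
Hypothesis cK : forall i, concave_kernel (Ks i).

Definition Fsum_but (k : 'I_n) y t : \bar R :=
  (Ks ord0 t + \sum_(j < n | j != k) Ks (lift ord0 j) (t - y j)%R)%E.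

Lemma Fsum_butE k y t :
  Fsum Ks y t = (Fsum_but k y t + Ks (lift ord0 k) (t - y k)%R)%E.
Proof. by rewrite /Fsum (bigD1 k) //= addeA addeAC. Qed.

Lemma Fsum_but_neqy k y t : Fsum_but k y t != +oo%E.
Proof.
rewrite -ltey lte_add_pinfty ?ltey ?kernel_neqy //.
by rewrite -ltey lte_sum_pinfty // => j _; rewrite ltey kernel_neqy.
Qed.

(** Joint continuity in nodes and point. Addition of extended reals is continuous here because no
    kernel takes the value [+oo]. *)
Lemma Fsum_cvg T (F : set_system T) {FF : Filter F}
    (y : T -> 'I_n -> R) y0 (t : T -> R) t0 :
  (forall j, y p j @[p --> F] --> y0 j) -> t @ F --> t0 ->
  Fsum Ks (y p) (t p) @[p --> F] --> Fsum Ks y0 t0.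
Proof.
move=> yF tF.
have Kcvg i (f : T -> R) (x : R) : f @ F --> x ->
    Ks i (f p) @[p --> F] --> Ks i x.
  by move=> fx; apply: continuous_cvg fx; exact: kernel_continuous.
apply: cvgeD; [|exact: Kcvg|].
  apply: ltpinfty_adde_def; rewrite inE ltey ?kernel_neqy //.
  by rewrite -ltey lte_sum_pinfty // => j _; rewrite ltey kernel_neqy.
elim: (index_enum 'I_n) => [|j r IHr].
  rewrite big_nil; under eq_fun do rewrite big_nil; exact: cvg_cst.
rewrite big_cons; under eq_fun do rewrite big_cons.
apply: cvgeD IHr; last by apply: Kcvg; exact: cvgB.
apply: ltpinfty_adde_def; rewrite inE ltey ?kernel_neqy //.
by rewrite -ltey lte_sum_pinfty // => i _; rewrite ltey kernel_neqy.
Qed.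

(** Only the kernel of the moved node changes. As [u] and [t] lie on the same side of the moved
    stretch, all four arguments of that kernel fit into one period, and [kernel_shift] shows that
    the move favours the right-hand point [t]. *)
Lemma Fsum_raise y y' (k : 'I_n) u t : (forall j, j != k -> y' j = y j) ->
  0 <= y k -> y k < y' k -> y' k <= twopi ->
  0 <= u -> u <= t -> t <= twopi -> y' k <= u \/ t <= y k ->
  (Fsum Ks y u <= Fsum Ks y t)%E -> (Fsum Ks y' u <= Fsum Ks y' t)%E.
Proof.
move=> y'E yk0 yy' yk2 u0; rewrite le_eqVlt => /orP[/eqP -> //|ut] t2 side.
have but v : Fsum_but k y' v = Fsum_but k y v.
  by congr (_ + _)%E; apply: eq_bigr => j jk; rewrite y'E.
rewrite !(Fsum_butE k) !but.
pose K := Ks (lift ord0 k).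
(* Adding two inequalities and cancelling, in extended reals: only the two cancelled or isolated
   terms [gr] and [gse] have to be finite. *)
have cancel (a b gr gs gre gse : \bar R) : a != +oo%E -> b != +oo%E ->
    gs != +oo%E -> gre != +oo%E -> gr \is a fin_num -> gse \is a fin_num ->
    (gs + gre <= gse + gr)%E -> (a + gr <= b + gs)%E -> (a + gre <= b + gse)%E.
  move: a b gr gs gre gse => [a||] [b||] [gr||] [gs||] [gre||] [gse||] //=.
  all: rewrite -?EFinD ?addeNy ?addNye ?leNye ?lee_fin //.
  by move=> *; lra.
have fin w : 0 < w < twopi -> K w \is a fin_num by exact: (kernel_fin (cK _)).
(* To the right of the stretch the arguments already lie in the period; to its left they are brought
   there by adding [twopi]. *)
have [z [r0 s2]] : exists z : int, y' k - y k <= u - y k + z%:~R * twopi /\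
    t - y k + z%:~R * twopi <= twopi.
  case: side => [uk|tk]; [exists 0|exists 1]; rewrite ?mul0r ?mul1r; lra.
have Kz w : K w = K (w + z%:~R * twopi) by rewrite /K (kernel_periodicz (cK _)).
rewrite -!/(K _) (Kz (u - y k)) (Kz (t - y k)) (Kz (u - y' k)) (Kz (t - y' k)).
have -> : u - y' k + z%:~R * twopi = u - y k + z%:~R * twopi - (y' k - y k).
  by ring.
have -> : t - y' k + z%:~R * twopi = t - y k + z%:~R * twopi - (y' k - y k).
  by ring.
set r := u - y k + _ in r0 *; set q := t - y k + _ in s2 *.
have rq : r < q by rewrite /r /q; lra.
have cKk : concave_kernel K by exact: cK.
apply: cancel; rewrite ?Fsum_but_neqy ?(kernel_neqy cKk) //;
  try by apply: fin; lra.
by apply: kernel_shift => //; lra.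
Qed.

(** A strict gap over a whole interval survives small moves of the nodes. The interval moves too, so
    its points are described by their relative position [c] in the fixed compact set [[0, 1]], over
    which the local estimates become uniform. *)
Lemma Fsum_gap_near T (F : set_system T) {FF : Filter F} (y : T -> 'I_n -> R) y0
    (i j : 'I_n.+1) t :
  (forall j, y p j @[p --> F] --> y0 j) -> closed_simplex s y0 ->
  node s y0 i <= t <= node s y0 i.+1 ->
  (forall u, node s y0 j <= u <= node s y0 j.+1 ->
     (Fsum Ks y0 u < Fsum Ks y0 t)%E) ->
  \forall p \near F, closed_simplex s (y p) ->
    exists2 t', node s (y p) i <= t' <= node s (y p) i.+1 &
      forall u, node s (y p) j <= u <= node s (y p) j.+1 ->
        (Fsum Ks (y p) u < Fsum Ks (y p) t')%E.
Proof.
move=> yF y0S ti gap.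
pose pt (z : 'I_n -> R) (i : 'I_n.+1) (c : R) :=
  node s z i + c * (node s z i.+1 - node s z i).
have ptP z (l : 'I_n.+1) (c : R) : closed_simplex s z -> 0 <= c <= 1 ->
    node s z l <= pt z l c <= node s z l.+1.
  move=> zS c01; have := zS l; rewrite /pt => ?.
  by apply/andP; split; nra.
have ptE z (l : 'I_n.+1) (v : R) : closed_simplex s z ->
    node s z l <= v <= node s z l.+1 ->
    exists2 c : R, 0 <= c <= 1 & v = pt z l c.
  move=> zS vl; have := zS l; rewrite le_eqVlt => /orP[/eqP zE|lt].
    by exists 0; rewrite ?lexx ?ler01 // /pt; lra.
  exists ((v - node s z l) / (node s z l.+1 - node s z l)).
    move/andP: vl => [v1 v2]; rewrite ler_pdivrMr ?subr_gt0 // mul1r.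
    by rewrite divr_ge0 ?subr_ge0 ?(ltW lt) //= lerD2r.
  by rewrite /pt mulfVK ?subrKC // subr_eq0 gt_eqF.
have [c0 c01 tE] := ptE _ _ _ y0S ti.
have cpt T' (F' : set_system T') (FF' : Filter F') (z : T' -> 'I_n -> R)
    (c : T' -> R) c' l : (forall j, z p j @[p --> F'] --> y0 j) ->
    c @ F' --> c' ->
    Fsum Ks (z p) (pt (z p) l (c p)) @[p --> F'] --> Fsum Ks y0 (pt y0 l c').
  move=> zF cF; apply: Fsum_cvg => //.
  apply: cvgD; first exact: node_cvg.
  by apply: cvgM => //; apply: cvgB; exact: node_cvg.
have /compact_near_coveringP cov := @segment_compact R 0 1.
suff : \forall p \near F, `[0, 1] `<=` (fun c =>
    (Fsum Ks (y p) (pt (y p) j c) < Fsum Ks (y p) (pt (y p) i c0))%E).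
  apply: filterS => p H pS.
  exists (pt (y p) i c0); first exact: ptP.
  move=> u /(ptE _ _ _ pS)[c c1 ->]; apply: H.
  by rewrite /= in_itv.
apply: (cov T F (fun p c =>
  (Fsum Ks (y p) (pt (y p) j c) < Fsum Ks (y p) (pt (y p) i c0))%E) FF) => c /=.
rewrite in_itv /= => c1.
have Hlt : (Fsum Ks y0 (pt y0 j c) < Fsum Ks y0 (pt y0 i c0))%E.
  by rewrite -tE; apply: gap; exact: ptP.
have F2 : p.2 @[p --> filter_prod (nbhs c) F] --> F by exact: cvg_snd.
have yF2 l : y p.2 l @[p --> filter_prod (nbhs c) F] --> y0 l.
  by apply: cvg_comp F2 (yF l).
have F1 : p.1 @[p --> filter_prod (nbhs c) F] --> c by exact: cvg_fst.
exact: cvge_lt_near (cpt _ _ _ _ _ _ j yF2 F1)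
                    (cpt _ _ _ _ _ _ i yF2 (cvg_cst c0)) Hlt.
Qed.

End Nodes.

(** * Existence *)

Section Existence.
Variables (R : realType) (n : nat) (s : {perm 'I_n}).
Variable Ks : 'I_n.+1 -> R -> \bar R.
Hypothesis cK : forall i, concave_kernel (Ks i).
Implicit Types (y : 'I_n -> R) (t u : R).
Notation twopi := (twopi R).

(* m_k(y) <= m_l(y), phrased without suprema *)
Definition level_le y (k l : nat) :=
  forall u, node s y k <= u <= node s y k.+1 -> exists2 t, node s y l <= t <= node s y l.+1 & (Fsum Ks y u <= Fsum Ks y t)%E.

Definition levels_sorted y :=
  closed_simplex s y /\ forall k : 'I_n, level_le y k k.+1.

Lemma level_le_msup y k l : level_le y k l -> (msup Ks s y k <= msup Ks s y l)%E.
Proof.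
move=> kl; apply: ge_ereal_sup => _ [u uk <-].
have [t tl ut] := kl u uk.
by apply: le_trans ut _; apply: ereal_sup_ubound; exists t.
Qed.

(** At the origin every interval but the last is the single point 0, and the last one contains 0. *)
Lemma levels_sorted0 : levels_sorted (fun=> 0).
Proof.
have node0 k : (k <= n)%N -> node s (fun=> 0 : R) k = 0.
  by case: k => [//|k] kn; rewrite -[k]/(val (Ordinal kn)) nodeS.
split=> k.
  rewrite node0 -1?ltnS ?ltn_ord //; case: (ltnP k n) => [kn|nk].
    by rewrite node0.
  have -> : k = n :> nat by have := ltn_ord k; lia.
  by rewrite node_last ltW // twopi_gt0.
move=> u; rewrite (node0 k) 1?ltnW ?ltn_ord // (node0 k.+1) ?ltn_ord //.
rewrite -eq_le => /eqP <-.
exists 0 => //; rewrite lexx andTb.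
have [kn|nk] := ltnP k.+1 n; first by rewrite node0.
have -> : k.+1 = n :> nat by have := ltn_ord k; lia.
by rewrite node_last ltW // twopi_gt0.
Qed.

(** Both ways of failing are open: a strict inversion of two nodes persists, and so does a strict
    gap between neighbouring intervals. Row vectors supply the topology used for compactness. *)
Lemma levels_sorted_closed :
  closed [set v : 'rV[R]_n | levels_sorted (v ord0)].
Proof.
rewrite -openC openE => v /= vA.
pose y (w : 'rV[R]_n) : 'I_n -> R := w ord0.
have yF j : y w j @[w --> v] --> y v j by exact: coord_continuous.
have [vS|] := pselect (closed_simplex s (y v)); last first.
  move=> /existsNP[k /negP]; rewrite -ltNge -subr_gt0 => kk.
  have cvk : node s (y w) k - node s (y w) k.+1 @[w --> v] -->
      node s (y v) k - node s (y v) k.+1 by exact: cvgB (node_cvg yF) (node_cvg yF).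
  have lt : \forall w \near v, 0 < node s (y w) k - node s (y w) k.+1.
    exact: cvgr_gt cvk _ kk.
  by apply: filterS lt => w wk [/(_ k)]; rewrite leNgt -subr_gt0 wk.
have {vA} [k /existsNP[u /not_implyP[uk]]] :
    exists k : 'I_n, ~ level_le (y v) k k.+1.
  by apply/existsNP => H; apply: vA.
move=> /forall2NP H.
have gap t : node s (y v) k.+1 <= t <= node s (y v) k.+2 ->
    (Fsum Ks (y v) t < Fsum Ks (y v) u)%E.
  by move=> tk; rewrite ltNge; apply/negP => ut; case: (H t).
have uk' : node s (y v) (widen_ord (leqnSn n) k) <= u <=
  node s (y v) (widen_ord (leqnSn n) k).+1 by [].
have near_gap := Fsum_gap_near cK (j := lift ord0 k) yF vS uk' gap.
apply: filterS (near_gap _) => w wgap [wS wle]; have [t tk tgap] := wgap wS.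
by have [x xk] := wle k t tk; rewrite leNgt tgap.
Qed.

Lemma levels_sorted_raise y (k : 'I_n) : levels_sorted y ->
  ~ level_le y k.+1 k ->
  exists2 e : R, 0 < e & levels_sorted (fun j => y j + e * (j == s k)%:R).
Proof.
move=> [yS yle] /existsNP[t /not_implyP[tk /forall2NP ntk]].
have gap u : node s y k <= u <= node s y k.+1 -> (Fsum Ks y u < Fsum Ks y t)%E.
  by move=> uk; rewrite ltNge; apply/negP => tu; case: (ntk u).
(* There is room for a move to the right: otherwise [t] would be the common end of both intervals
   and would have to exceed itself. *)
have lt : node s y k.+1 < node s y k.+2.
  rewrite lt_neqAle (yS (lift ord0 k)) andbT; apply/eqP => kk.
  have : node s y k <= t <= node s y k.+1.
    move: tk; rewrite -kk -eq_le => /eqP <-; rewrite lexx andbT.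
    exact: (yS (widen_ord (leqnSn n) k)).
  by move=> /gap; rewrite ltxx.
pose y' e j := y j + e * (j == s k)%:R.
have y'F j : y' e j @[e --> 0^'+] --> y j.
  rewrite -[X in _ --> X]addr0 -[X in _ + X](mul0r (j == s k)%:R).
  apply: cvgD; first exact: cvg_cst.
  by apply: cvgMr_tmp; exact: cvg_at_right_filter.
have tk' : node s y (lift ord0 k : 'I_n.+1) <= t <=
  node s y (lift ord0 k : 'I_n.+1).+1 by [].
have near_gap := Fsum_gap_near cK (j := widen_ord (leqnSn n) k) y'F yS tk' gap.
have [e [e0 ek egap]] : exists e : R, [/\ 0 < e, e <= node s y k.+2 - node s y k.+1 &
    closed_simplex s (y' e) ->
    exists2 t', node s (y' e) k.+1 <= t' <= node s (y' e) k.+2 &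
      forall u, node s (y' e) k <= u <= node s (y' e) k.+1 ->
        (Fsum Ks (y' e) u < Fsum Ks (y' e) t')%E].
  near (0 : R)^'+ => e; exists e; split.
  - by near: e; exact: nbhs_right_gt.
  - by near: e; apply: nbhs_right_le; rewrite subr_gt0.
  - by near: e; exact: near_gap.
have y'E i : node s (y' e) i = node s y i + e * (i == k.+1)%:R.
  exact: node_raise.
have y'S : closed_simplex s (y' e).
  move=> i; rewrite !y'E eqSS; have := yS i.
  have [->|_] := eqVneq (i : nat) k.+1.
    by rewrite (gtn_eqF (ltnSn k)) mulr1 mulr0 addr0 -lerBrDl.
  rewrite mulr0 addr0.
  by have [_|_] := eqVneq (i : nat) k; rewrite ?mulr1 ?mulr0; lra.
exists e => //; split=> // l u ul.
have [lk|lk] := eqVneq l k.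
  rewrite lk in ul *; have [t' t'k t'gap] := egap y'S.
  by exists t' => //; apply: ltW; exact: t'gap.
(* For the other pairs, the interval containing [u] can only have shrunk and the one containing [t']
   can only have grown, so the old comparison supplies the witness. *)
have {}lk : (l == k :> nat) = false by apply/negbTE; rewrite val_eqE.
have {yle}[|t' t'l ut'] := yle l u.
  move: ul; rewrite !y'E eqSS lk mulr0 addr0 => /andP[lu ->].
  rewrite andbT (le_trans _ lu) // lerDl mulr_ge0 ?ler0n //; lra.
exists t'.
  move: t'l; rewrite !y'E !eqSS lk mulr0 addr0 => /andP[-> t'l].
  by rewrite (le_trans t'l) // lerDl mulr_ge0 ?ler0n //; lra.
have b0 := coord_bounds (s k) yS; have b0' := coord_bounds (s k) y'S.
have /andP[lu0 _] := @node_bounds _ _ s _ l y'S (leqW (ltnW (ltn_ord l))).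
have /andP[_ lt2] := @node_bounds _ _ s _ l.+2 yS (ltn_ord l).
move: ul t'l => /andP[ul1 ul2] /andP[tl1 tl2].
apply: (Fsum_raise cK (k := s k)) ut' => //.
- by move=> j /negbTE jk; rewrite /y' jk mulr0 addr0.
- by case/andP: b0.
- by rewrite /y' eqxx mulr1 ltrDl.
- by case/andP: b0'.
- exact: le_trans ul1.
- by apply: le_trans ul2 _; rewrite y'E eqSS lk mulr0 addr0.
- exact: le_trans lt2.
(* Intervals [l] and [l.+1] are both to the left of the moved node when [l < k], and both to its
   right when [l > k]. *)
suff : node s (y' e) k.+1 <= u \/ t' <= node s y k.+1 by rewrite !nodeS.
move: lk; case: ltngtP => // lk _; [right|left].
  by apply: le_trans tl2 _; apply: node_mono; rewrite // !ltnS lk ltnW.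
by apply: le_trans ul1; apply: (@node_mono _ _ s (y' e)); rewrite // lk leqW // ltnW.
Unshelve. all: by end_near.
Qed.

Lemma equioscillation_exists : exists y, equioscillation_point Ks s y.
Proof.
pose A := [set v : 'rV[R]_n | levels_sorted (v ord0)].
have A0 : A !=set0.
  exists (\row_j 0); rewrite /A /=.
  have -> : (\row_j (0 : R)) ord0 = (fun=> 0) :> ('I_n -> R).
    by apply/funext => j; rewrite mxE.
  exact: levels_sorted0.
have cA : compact A.
  apply: subclosed_compact levels_sorted_closed
    (rV_compact (fun=> @segment_compact R 0 twopi)) _.
  by move=> v [vS _] i; rewrite /= in_itv /= (coord_bounds _ vS).
have [|v /set_mem vA vmax] := @EVT_max_rV R n (fun v => \sum_j v ord0 j) A A0 cA.
  apply: continuous_subspaceT; apply: (continuous_big add_continuous) => j _.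
  exact: coord_continuous.
exists (v ord0); split; first by case: vA.
(* One inequality is sortedness; were the other to fail, raising one coordinate by [e] would give a
   sorted point with a larger coordinate sum. *)
have eqS (k : 'I_n) : msup Ks s (v ord0) k = msup Ks s (v ord0) k.+1.
  suff le2 : level_le (v ord0) k.+1 k.
    by apply/eqP; rewrite eq_le !level_le_msup //; case: vA.
  apply: contrapT => nk.
  have [e e0 y'A] := levels_sorted_raise vA nk.
  have := vmax (\row_j (v ord0 j + e * (j == s k)%:R)).
  rewrite mem_set; last first.
    rewrite /A /=; congr levels_sorted: y'A.
    by apply/funext => j; rewrite mxE.
  move=> /(_ isT); under eq_bigr do rewrite mxE.
  have S1 : \sum_(j < n) (j == s k)%:R = 1 :> R.
    by rewrite (bigD1 (s k)) //= eqxx big1 ?addr0 // => i /negbTE ->.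
  by rewrite big_split /= -mulr_sumr S1 mulr1 gerDl leNgt e0.
have eq0 (k : nat) : (k <= n)%N -> msup Ks s (v ord0) k = msup Ks s (v ord0) 0.
  by elim: k => // k IHk kn; rewrite -(eqS (Ordinal kn)) /= IHk // ltnW.
by move=> k l; rewrite !eq0 // -ltnS.
Qed.

End Existence.

(** * Interior *)

Section Interior.
Variables (R : realType) (n : nat) (s : {perm 'I_n}).
Variable Ks : 'I_n.+1 -> R -> \bar R.
Hypothesis sK : forall i, strictly_concave_kernel (Ks i).
Implicit Types (y : 'I_n -> R) (t u p : R).
Notation twopi := (twopi R).

Let cK i : concave_kernel (Ks i) := (sK i).1.

(** The position of the singularity of each kernel, with 0 for the fixed kernel, so that all [n.+1]
    kernels are treated alike. *)
Definition kcenter y (i : 'I_n.+1) : R :=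
  if unlift ord0 i is Some j then y j else 0.

Lemma kcenter0 y : kcenter y ord0 = 0.
Proof. by rewrite /kcenter unlift_none. Qed.

Lemma kcenterS y j : kcenter y (lift ord0 j) = y j.
Proof. by rewrite /kcenter liftK. Qed.

Lemma Fsum_kcenter y t : Fsum Ks y t = (\sum_i Ks i (t - kcenter y i)%R)%E.
Proof.
rewrite big_ord_recl kcenter0 subr0; congr (_ + _)%E.
by apply: eq_bigr => j _; rewrite kcenterS.
Qed.

Lemma simplex_cover y t : closed_simplex s y -> 0 <= t <= twopi ->
  exists k : 'I_n.+1, node s y k <= t <= node s y k.+1.
Proof.
move=> yS /andP[t0 t2].
suff H m : (m <= n)%N -> t <= node s y m.+1 ->
    exists k : 'I_n.+1, node s y k <= t <= node s y k.+1.
  by apply: (H n) => //; rewrite node_last.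
elim: m => [|m IHm] mn tm; first by exists ord0; rewrite tm andbT.
have [tm'|mt] := leP t (node s y m.+1); first exact: IHm (ltnW mn) tm'.
by exists (Ordinal (mn : (m.+1 < n.+1)%N)); rewrite /= (ltW mt).
Qed.

(** The supremum over a one-point interval is the value of F there. Modulo the period any [t] lies
    in some interval, and all interval suprema are equal. *)
Lemma degenerate_max y (k : 'I_n.+1) : equioscillation_point Ks s y ->
  node s y k = node s y k.+1 ->
  forall t, (Fsum Ks y t <= Fsum Ks y (node s y k))%E.
Proof.
move=> [yS ym] kk t.
have [z /andP[r0 r2]] := twopi_mod t.
have -> : Fsum Ks y t = Fsum Ks y (t + z%:~R * twopi).
  rewrite !Fsum_kcenter; apply: eq_bigr => i _.
  by rewrite addrAC (kernel_periodicz (cK i)).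
have [|j tj] := simplex_cover yS (t := t + z%:~R * twopi).
  by rewrite r0 ltW.
apply: (@le_trans _ _ (msup Ks s y j)).
  by apply: ereal_sup_ubound; exists (t + z%:~R * twopi).
rewrite (ym j k); apply: ge_ereal_sup => _ [u uk <-]; move: uk.
by rewrite /mkset -kk -eq_le => /eqP <-.
Qed.

(** Equality on the torus, so that 0 and [twopi] count as the same singularity of the fixed
    kernel. *)
Definition at_node y p i := exists z : int, p - kcenter y i = z%:~R * twopi.

(** Each end of the interval contributes a kernel, namely the fixed one when that end is 0 or
    [twopi]. Both ends cannot come from the fixed kernel, since 0 and [twopi] differ. *)
Lemma degenerate_pair y (k : 'I_n.+1) : closed_simplex s y ->
  node s y k = node s y k.+1 ->
  exists i j, [/\ i != j, at_node y (node s y k) i & at_node y (node s y k) j].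
Proof.
move=> yS; have twopi0 := twopi_gt0 R.
case: k => -[|k] kn; rewrite [nat_of_ord _]/=.
  have [n0|n0] := posnP n.
    by rewrite -{2}n0 node_last => E; move: twopi0; rewrite -E ltxx.
  rewrite (nodeS s y (Ordinal n0)) => E.
  exists ord0, (lift ord0 (s (Ordinal n0))); split=> //.
    by exists 0; rewrite kcenter0 mul0r subr0.
  by exists 0; rewrite kcenterS -E mul0r subr0.
have {}kn : (k < n)%N := kn.
rewrite (nodeS s y (Ordinal kn)) => E.
have ik : at_node y (y (s (Ordinal kn))) (lift ord0 (s (Ordinal kn))).
  by exists 0; rewrite kcenterS subrr mul0r.
have [k1|k1] := ltnP k.+1 n.
  exists (lift ord0 (s (Ordinal kn))), (lift ord0 (s (Ordinal k1))); split=> //.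
    by rewrite (inj_eq lift_inj) (inj_eq perm_inj) -val_eqE /= ltn_eqF.
  by exists 0; rewrite kcenterS E (nodeS s y (Ordinal k1)) subrr mul0r.
exists (lift ord0 (s (Ordinal kn))), ord0; split=> //.
exists 1; rewrite kcenter0 subr0 mul1r E.
have -> : k.+1 = n by apply/eqP; rewrite eqn_leq kn k1.
exact: node_last.
Qed.

(** All kernels are finite just to the right of 0, so the maximum of F is not [-oo] and no summand
    can be. *)
Lemma fin_max y p : (forall t, (Fsum Ks y t <= Fsum Ks y p)%E) ->
  forall i, Ks i (p - kcenter y i) \is a fin_num.
Proof.
move=> pmax i; rewrite fin_numE kernel_neqy // andbT; apply/eqP => Ki.
have [t tfin] : exists t, forall i, Ks i (t - kcenter y i) \is a fin_num.
  near (0 : R)^'+ => h; exists h.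
  near: h; apply: filter_forall => j.
  by under eq_near do rewrite addrC; exact: kernel_fin_right.
have := pmax t; rewrite !Fsum_kcenter.
have -> : (\sum_i Ks i (p - kcenter y i)%R)%E = -oo%E.
  by apply/eqP; rewrite esum_eqNy; apply/existsP; exists i; rewrite Ki eqxx.
rewrite leeNy_eq => /eqP Ft.
have : (\sum_i Ks i (t - kcenter y i)%R)%E \is a fin_num.
  by apply/sum_fin_numP => j _ _.
by rewrite Ft.
Unshelve. all: by end_near.
Qed.

Lemma max_increment y p (e : R) : e = 1 \/ e = -1 ->
  (forall t, (Fsum Ks y t <= Fsum Ks y p)%E) -> \forall h \near 0^'+,
    \sum_i (kr (Ks i) (p - kcenter y i + e * h) - kr (Ks i) (p - kcenter y i)) <= 0.
Proof.
move=> e1 pmax; have pfin := fin_max pmax.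
have hfin : \forall h \near 0^'+, forall i,
    Ks i (p - kcenter y i + e * h) \is a fin_num.
  by apply: filter_forall => i; exact: kernel_fin_side.
apply: filterS hfin => h hfin; rewrite sumrB subr_le0 -lee_fin.
rewrite !EFin_sum_fine //.
have := pmax (p + e * h); rewrite !Fsum_kcenter.
by under eq_bigr do rewrite addrAC.
Qed.

(** On its steep side kernel [i] rises faster than any linear rate, while the other kernels fall at
    most at fixed linear rates; F thus increases away from [p]. *)
Lemma no_max_inf' y p i :
  (forall t, (Fsum Ks y t <= Fsum Ks y p)%E) -> at_node y p i ->
  ~ cond_inf' (Ks i).
Proof.
move=> pmax [z iz] Kinf.
have pfin := fin_max pmax.
have K0 : Ks i 0 \is a fin_num.
  by have := pfin i; rewrite iz -[z%:~R * _]add0r kernel_periodicz.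
have [e e1 slope] : exists2 e : R, e = 1 \/ e = -1 & forall M, \forall h \near 0^'+,
    M * h <= kr (Ks i) (p - kcenter y i + e * h) - kr (Ks i) (p - kcenter y i).
  have krE h : kr (Ks i) (p - kcenter y i + h) = kr (Ks i) h.
    by rewrite /kr iz addrC kernel_periodicz.
  have krE0 : kr (Ks i) (p - kcenter y i) = kr (Ks i) 0.
    by rewrite -(krE 0) addr0.
  have [H|H] := cond_inf'_slope (cK i) K0 Kinf; [exists 1|exists (-1)].
  - by left.
  - by move=> M; apply: filterS (H M) => h; rewrite krE krE0 mul1r.
  - by right.
  - by move=> M; apply: filterS (H M) => h; rewrite krE krE0 mulN1r.
have [C HC] := choice (fun i => kernel_lipschitz_side (cK i) e1 (pfin i)).
pose S := \sum_(j | j != i) C j.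
have pos_near : \forall h \near 0^'+,
    0 < \sum_i (kr (Ks i) (p - kcenter y i + e * h) - kr (Ks i) (p - kcenter y i)).
  (* The rate [1 - S] for kernel [i] makes all the rates add up to 1. *)
  apply: (sum_gt0_near (C := fun j => if j == i then 1 - S else C j)) => [j|].
    by case: eqP => [->|_].
  rewrite (bigD1 i) //= eqxx.
  have -> : \sum_(j | j != i) (if j == i then 1 - S else C j) = S.
    by apply: eq_bigr => j /negbTE ->.
  by rewrite subrK.
have [h [h1]] := filter_ex (filterI pos_near (max_increment e1 pmax)).
by rewrite leNgt h1.
Qed.

(** Increments on both sides of [p] are added. Kernels singular at [p] contribute a positive
    multiple of [h], differentiable ones lose an arbitrarily small multiple, whereas a maximum would
    make the total nonpositive. *)
Lemma no_max_C1 y p i :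
  (forall t, (Fsum Ks y t <= Fsum Ks y p)%E) -> at_node y p i ->
  ~ (forall i, C1_kernel (Ks i)).
Proof.
move=> pmax iz C1; have pfin := fin_max pmax.
pose g j h := (kr (Ks j) (p - kcenter y j + h) - kr (Ks j) (p - kcenter y j)) +
              (kr (Ks j) (p - kcenter y j - h) - kr (Ks j) (p - kcenter y j)).
have at_nodeP j : at_node y p j -> exists2 c, 0 < c &
    \forall h \near 0^'+, c * h <= g j h.
  move=> [z jz].
  have krE h : kr (Ks j) (p - kcenter y j + h) = kr (Ks j) h.
    by rewrite /kr jz addrC (kernel_periodicz (cK j)).
  have krE0 : kr (Ks j) (p - kcenter y j) = kr (Ks j) 0 by rewrite -(krE 0) addr0.
  have K0 : Ks j 0 \is a fin_num.
    by have := pfin j; rewrite jz -[z%:~R * _]add0r (kernel_periodicz (cK j)).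
  have [c c0 Hc] := kernel_second_difference0 (sK j) K0; exists c => //.
  by apply: filterS Hc => h; rewrite /g !krE krE0.
have [c c0 Hc] := at_nodeP i iz.
(* There are [n.+1] kernels, each losing at most [d * h], and [n.+1] times [d] is less than [c]. *)
pose d := c / n.+2%:R.
have d0 : 0 < d by rewrite divr_gt0.
have pos_near : \forall h \near 0^'+, 0 < \sum_j g j h.
  apply: (sum_gt0_near (C := fun j => c * (j == i)%:R - d)) => [j|].
    have [->|ji] := eqVneq j i.
      near=> h; have h0 : 0 < h by near: h; exact: nbhs_right_gt.
      apply: (@le_trans _ _ (c * h)); last by near: h.
      by rewrite mulr1 ler_pM2r // gerBl ltW.
    rewrite mulr0 sub0r.
    have [z zj] := twopi_mod (p - kcenter y j).
    have [r0|r0] := eqVneq (p - kcenter y j + z%:~R * twopi) 0.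
      have [|b b0 Hb] := at_nodeP j.
        by exists (- z); rewrite mulrNz mulNr; apply/eqP; rewrite -addr_eq0 r0.
      near=> h; have h0 : 0 < h by near: h; exact: nbhs_right_gt.
      apply: (@le_trans _ _ (b * h)); last by near: h.
      by rewrite ler_pM2r //; lra.
    have r2 : 0 < p - kcenter y j + z%:~R * twopi < twopi.
      by move: zj; rewrite [in X in _ -> X]lt_neqAle eq_sym r0.
    have := derivable_second_difference ((C1 j).1 _ r2) d0.
    apply: filterS => h; rewrite /g.
    have krE x : kr (Ks j) (x + z%:~R * twopi) = kr (Ks j) x.
      by rewrite /kr (kernel_periodicz (cK j)).
    by rewrite (addrAC _ _ h) (addrAC _ _ (- h)) !krE.
  rewrite sumrB -mulr_sumr sumr_const card_ord.
  have -> : \sum_j (j == i)%:R = 1 :> R.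
    by rewrite (bigD1 i) //= eqxx big1 ?addr0 // => l /negbTE ->.
  rewrite mulr1 subr_gt0 -mulr_natr /d mulrAC ltr_pdivrMr ?ltr0n //.
  by rewrite ltr_pM2l // ltr_nat.
have [h [h1 [h2 h3]]] := filter_ex (filterI pos_near (filterI
  (max_increment (or_introl erefl) pmax) (max_increment (or_intror erefl) pmax))).
have : \sum_j g j h <= 0.
  have := lerD h2 h3; rewrite addr0 -big_split /=.
  by under eq_bigr do rewrite mul1r mulN1r.
by rewrite leNgt h1.
Unshelve. all: by end_near.
Qed.

Lemma equioscillation_interior :
  (forall i, C1_kernel (Ks i)) \/
  (exists A : {set 'I_n.+1},
     (n <= #|A|)%N /\ forall i, i \in A -> cond_inf' (Ks i)) ->
  forall y, equioscillation_point Ks s y -> open_simplex s y.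
Proof.
move=> hyp y eqy k; have yS := eqy.1; rewrite lt_neqAle yS andbT.
apply/eqP => kk.
have pmax := degenerate_max eqy kk.
have [i [j [ij iz jz]]] := degenerate_pair yS kk.
case: hyp => [C1|[A [nA Ainf]]]; first exact: (no_max_C1 pmax iz).
have [iA|iA] := boolP (i \in A); first exact: no_max_inf' pmax iz (Ainf i iA).
have [jA|jA] := boolP (j \in A); first exact: no_max_inf' pmax jz (Ainf j jA).
(* If neither [i] nor [j] were in [A], the union would have at least [n + 2] elements among [n.+1]
   indices. *)
have : (#|A :|: [set i; j]| <= n.+1)%N.
  by rewrite -[X in (_ <= X)%N]card_ord max_card.
rewrite cardsU cards2 ij.
have -> : A :&: [set i; j] = finset.set0.
  apply/setP => l; rewrite !inE; apply/negbTE; apply/negP.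
  by case/andP => lA /orP[] /eqP E; move: iA jA; rewrite -?E lA.
rewrite cards0; lia.
Qed.

End Interior.

Theorem theorem10p4 (R : realType) (n : nat) (Ks : 'I_n.+1 -> R -> \bar R) :
  (forall i, strictly_concave_kernel (Ks i)) ->
  forall s : {perm 'I_n},
    (exists y : 'I_n -> R, equioscillation_point Ks s y) /\
    (((forall i, C1_kernel (Ks i)) \/
      (exists A : {set 'I_n.+1}, (n <= #|A|)%N /\ forall i, i \in A -> cond_inf' (Ks i))) ->
     forall y : 'I_n -> R, equioscillation_point Ks s y -> open_simplex s y).
Proof.
move=> sK s; split; first exact: equioscillation_exists (fun i => (sK i).1).
exact: equioscillation_interior.
Qed.
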